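(* Let $n\ge2$, let $G$ be any finite group, let $W_n=G\wr S_n$, and let $\Gamma=([n],c)$ be a weighted hypergraph with non-negative weights. If Caputo's conjecture holds for $\Gamma$, i.e. if $\lambda_{\min}^*(\Gamma,\mathrm{Reg}_{S_n})=\lambda_{\min}(\Gamma,\mathrm{std}_n)$, then $$\lambda_{\min}^*\left(\Gamma,\mathrm{Reg}_{W_n}\right)=\lambda_{\min}^*\left(\Gamma,\mathrm{Reg}_{S_n}\right)=\lambda_{\min}\left(\Gamma,\mathrm{std}_n\right).$$
   Context: Notation: $[n]=\{1,\dots,n\}$; $e$ is the unit of a group. A weighted hypergraph $\Gamma=([n],c)$ is an assignment of a weight $c_B\in\mathbb{R}_{\ge 0}$ to every subset $B\subseteq[n]$. $W_n=G\wr S_n=G^n\rtimes S_n$ has elements $(\mathbf g;\sigma)$ with $\mathbf g=(g_1,\dots,g_n)\in G^n$, $\sigma\in S_n$, and multiplication $(g_1,\dots,g_n;\sigma)(h_1,\dots,h_n;\tau)=(g_1h_{\sigma^{-1}(1)},\dots,g_nh_{\sigma^{-1}(n)};\sigma\tau)$. For $B\subseteq[n]$: $S_B=\{\sigma\in S_n:\sigma(i)=i\ \forall i\notin B\}$, and $W_B=\{(\mathbf g;\sigma)\in W_n:\sigma\in S_B,\ g_i=e_G\ \forall i\notin B\}$. Put $$J_B=\frac1{|S_B|}\sum_{\pi\in S_B}\pi\in\mathbb{C}[S_n],\qquad J_B^{(G)}=\frac1{|W_B|}\sum_{w\in W_B}w\in\mathbb{C}[W_n],$$ $$\mathcal L_\Gamma=\sum_{B\subseteq[n]}c_B(e-J_B)\in\mathbb{C}[S_n],\qquad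 \mathcal L_\Gamma^{(G)}=\sum_{B\subseteq[n]}c_B(e-J_B^{(G)})\in\mathbb{C}[W_n].$$ Let $\phi$ be a finite-dimensional complex representation of $S_n$ (resp. $W_n$), extended linearly to the group algebra. The eigenvalues of $\phi(\mathcal L_\Gamma)$ (resp. $\phi(\mathcal L^{(G)}_\Gamma)$) are real and non-negative, and $\lambda_{\min}(\Gamma,\phi)$ denotes the smallest one. Write $\phi\cong\phi'\oplus k\cdot\mathrm{triv}$ with $k\ge0$ and $\phi'$ having no trivial component; then $\lambda_{\min}^*(\Gamma,\phi)$ denotes the smallest eigenvalue of $\phi'(\mathcal L_\Gamma)$ (resp. $\phi'(\mathcal L_\Gamma^{(G)})$), and is $\infty$ if $\phi'=0$. $\mathrm{Reg}_{S_n}$ and $\mathrm{Reg}_{W_n}$ are the left-regular representations on $\mathbb{C}[S_n]$ and $\mathbb{C}[W_n]$. $\mathrm{std}_n$ is the standard $(n-1)$-dimensional irreducible representation of $S_n$, i.e. the non-trivial irreducible constituent of the permutation representation of $S_n$ on $\mathbb{C}^n$. *)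

(* Defs.v *)
From HB Require Import structures.
From mathcomp Require Import all_boot all_order all_algebra all_fingroup.
From mathcomp Require Import all_character.
From mathcomp Require Import complex.
From mathcomp Require Import all_classical all_reals ereal.

Set Implicit Arguments.
Unset Strict Implicit.
Unset Printing Implicit Defensive.

Import Order.TTheory GRing.Theory Num.Theory.

Local Open Scope classical_set_scope.
Local Open Scope ring_scope.
Local Open Scope complex_scope.

Section Wreath.
Variables (G : finGroupType) (n : nat).

Record wreath := Wreath { wbase : {ffun 'I_n -> G}; wperm : 'S_n }.

Definition pair_of_wreath (w : wreath) := (wbase w, wperm w).
Definition wreath_of_pair (p : {ffun 'I_n -> G} * 'S_n) := Wreath p.1 p.2.

Lemma pair_of_wreathK : cancel pair_of_wreath wreath_of_pair.
Proof. by case. Qed.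

HB.instance Definition _ := Finite.copy wreath (can_type pair_of_wreathK).

Definition wreath_one : wreath := Wreath [ffun=> 1%g] 1%g.

Definition wreath_inv (u : wreath) : wreath :=
  Wreath [ffun i => (wbase u (wperm u i))^-1%g] (wperm u)^-1%g.

(* (g; s)(h; t) = (i |-> g_i h_(s^-1 i); s o t).  The product of ['S_n] applies
   its left factor first, so the composite s o t is [(t * s)%g]. *)
Definition wreath_mul (u v : wreath) : wreath :=
  Wreath [ffun i => (wbase u i * wbase v ((wperm u)^-1%g i))%g]
         (wperm v * wperm u)%g.

Lemma wreath_mulA : associative wreath_mul.
Proof.
move=> u v w; congr Wreath; last by rewrite /= mulgA.
by apply/ffunP=> i; rewrite !ffunE /= invMg permM mulgA.
Qed.

Lemma wreath_mul1 : left_id wreath_one wreath_mul.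
Proof.
case=> g s; rewrite /wreath_mul /= mulg1; congr Wreath.
by apply/ffunP=> i; rewrite !ffunE mul1g invg1 perm1.
Qed.

Lemma wreath_mulV : left_inverse wreath_one wreath_inv wreath_mul.
Proof.
case=> g s; rewrite /wreath_mul /= mulgV; congr Wreath.
by apply/ffunP=> i; rewrite !ffunE invgK mulVg.
Qed.

HB.instance Definition _ :=
  Finite_isGroup.Build wreath wreath_mulA wreath_mul1 wreath_mulV.

Definition wreath_sub (B : {set 'I_n}) : {set wreath} :=
  [set w | (wperm w \in Sym B) && [forall i, (i \notin B) ==> (wbase w i == 1%g)]].

End Wreath.

Section GroupAlgebra.
Variables (R : realType) (gT : finGroupType).

(* The group algebra C[gT], as finite functions. *)
Definition galg_one : {ffun gT -> R[i]} := [ffun g => (g == 1%g)%:R].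

Definition galg_avg (H : {set gT}) : {ffun gT -> R[i]} :=
  [ffun g => (g \in H)%:R / #|H|%:R].

Definition laplacian n (H : {set 'I_n} -> {set gT}) (c : {set 'I_n} -> R) :
    {ffun gT -> R[i]} :=
  \sum_(B : {set 'I_n}) (c B)%:C *: (galg_one - galg_avg (H B)).

Definition galg_mx (a : {ffun gT -> R[i]}) d
    (rho : mx_representation R[i] [set: gT]%G d) : 'M[R[i]]_d :=
  \sum_(g : gT) a g *: rho g.

Definition real_spectrum (a : {ffun gT -> R[i]}) d
    (rho : mx_representation R[i] [set: gT]%G d) : set R :=
  [set x | eigenvalue (galg_mx a rho) x%:C].

(* [ereal_inf] is the minimum of a nonempty finite set, and +oo on set0. *)
Definition lambda_min (a : {ffun gT -> R[i]}) d
    (rho : mx_representation R[i] [set: gT]%G d) : \bar R :=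
  ereal_inf (EFin @` real_spectrum a rho).

Lemma triv_mx_repr : mx_repr [set: gT]%G (fun=> 1%:M : 'M[R[i]]_1).
Proof. by split=> // g h _ _; rewrite mulmx1. Qed.

Definition triv_repr := MxRepresentation triv_mx_repr.

Definition no_trivial_component d
    (rho : mx_representation R[i] [set: gT]%G d) : Prop :=
  forall (U : 'M_d) (modU : mxmodule rho U),
    ~ mx_rsim (submod_repr modU) triv_repr.

Definition nontrivial_part d (rho : mx_representation R[i] [set: gT]%G d) d'
    (rho' : mx_representation R[i] [set: gT]%G d') : Prop :=
  no_trivial_component rho' /\
  exists k : nat,
    mx_rsim rho (dadd_grepr (Representation rho')
                            (muln_grepr (Representation triv_repr) k)).

(* The nontrivial part exists and is unique up to isomorphism, so the infimum
   ranges over the spectrum of a single operator. *)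
Definition lambda_min_star (a : {ffun gT -> R[i]}) d
    (rho : mx_representation R[i] [set: gT]%G d) : \bar R :=
  ereal_inf [set l | exists d' (rho' : mx_representation R[i] [set: gT]%G d'),
                       nontrivial_part rho rho' /\ l = lambda_min a rho'].

(* [Reg g] is the matrix, acting on column vectors, of left translation
   delta_h |-> delta_(g h). *)
Definition left_regular_mx (g : gT) : 'M[R[i]]_#|gT| :=
  \matrix_(i, j) (enum_val i == (g * enum_val j)%g)%:R.

Lemma left_regular_mx_repr : mx_repr [set: gT]%G left_regular_mx.
Proof.
split=> [|g h _ _]; apply/matrixP=> i j; rewrite !mxE.
  by rewrite mul1g (inj_eq enum_val_inj).
rewrite (bigD1 (enum_rank (h * enum_val j)%g)) //= big1 => [|k nk]; rewrite !mxE.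
  by rewrite enum_rankK eqxx mulr1 addr0 mulgA.
rewrite [X in _ * (nat_of_bool X)%:R](_ : _ = false) ?mulr0 //.
by apply: contra_neqF nk => /eqP <-; rewrite enum_valK.
Qed.

Definition Reg := MxRepresentation left_regular_mx_repr.

Lemma Reg_rsim : mx_rsim Reg (regular_repr R[i] [set: gT]%G).
Proof.
pose B : 'M[R[i]]_(#|gT|, #|[set: gT]%G|) :=
  \matrix_(i, j) (enum_val i == (enum_val j)^-1)%g%:R.
pose p (j : 'I_#|[set: gT]%G|) : 'I_#|gT| := enum_rank (enum_val j)^-1%g.
pose q (i : 'I_#|gT|) := gring_index [set: gT]%G (enum_val i)^-1%g.
have qE i : enum_val (q i) = (enum_val i)^-1%g by rewrite gring_indexK ?inE.
have BE i j : B i j = (q i == j)%:R.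
  by rewrite mxE -(inj_eq enum_val_inj) qE (can2_eq invgK invgK).
exists B; first by rewrite cardsT.
  apply/row_freeP; exists (B^T); apply/matrixP=> i j; rewrite !mxE.
  rewrite (bigD1 (q i)) //= big1 => [|k nk]; rewrite [B^T _ _]mxE !BE.
    rewrite eqxx mul1r addr0; congr (_%:R); rewrite eq_sym.
    by rewrite -(inj_eq enum_val_inj) !qE (inj_eq invg_inj) (inj_eq enum_val_inj).
  by rewrite eq_sym (negPf nk) mul0r.
move=> g _; apply/matrixP=> i j; rewrite [LHS]mxE [RHS]mxE.
rewrite (bigD1 (p j)) //= [X in _ + X]big1 => [|k nk]; last first.
  rewrite [B k j]mxE [X in _ * (nat_of_bool X)%:R](_ : _ = false) ?mulr0 //.
  by apply: contra_neqF nk => /eqP ek; rewrite /p -ek enum_valK.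
rewrite (bigD1 (q i)) //= [X in _ = _ + X]big1 => [|k nk]; last first.
  by rewrite BE eq_sym (negPf nk) mul0r.
rewrite !addr0 [B i _]BE eqxx mul1r !mxE enum_rankK.
rewrite [X in _ * (nat_of_bool X)%:R]eqxx mulr1 /=; congr (nat_of_bool _)%:R.
rewrite -[in RHS](inj_eq enum_val_inj) gring_indexK ?inE // qE.
apply/eqP/eqP => [->|ej]; first by rewrite invMg invgK mulgKV.
by rewrite ej invMg invgK mulKVg.
Qed.

End GroupAlgebra.

Section Standard.
Variables (R : realType) (n : nat).

Lemma perm_mx_repr : mx_repr [set: 'S_n]%G (fun s => perm_mx s : 'M[R[i]]_n).
Proof. by split=> [|s t _ _]; rewrite ?perm_mx1 ?perm_mxM. Qed.

Definition perm_repr := MxRepresentation perm_mx_repr.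

(* The row space of [sum0] is the space of vectors with zero coordinate sum. *)
Definition sum0 : 'M[R[i]]_n := kermx (const_mx 1 : 'cV_n).

Lemma sum0_module : mxmodule perm_repr sum0.
Proof.
apply/mxmoduleP=> s _; rewrite sub_kermx -mulmxA /=.
suff -> : perm_mx s *m (const_mx 1 : 'cV[R[i]]_n) = const_mx 1.
  by rewrite mulmx_ker.
by rewrite -row_permE; apply/matrixP=> i j; rewrite !mxE.
Qed.

Definition std := submod_repr sum0_module.

Lemma std_irr : (2 <= n)%N -> mx_irreducible std.
Proof.
move=> n2; apply/submod_mx_irr; split; first exact: sum0_module.
  rewrite -mxrank_eq0 mxrank_ker -lt0n subn_gt0.
  by apply: leq_ltn_trans n2; apply: rank_leq_col.
pose d i j : 'rV[R[i]]_n := delta_mx 0 i - delta_mx 0 j.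
have dP s i j : d i j *m perm_mx s = d (s i) (s j).
  rewrite mulmxBl -!rowE; congr (_ - _); apply/rowP=> k; rewrite !mxE eqxx /=;
  by rewrite eq_sym.
move=> V modV sV nzV.
have [v vV nzv] : exists2 v : 'rV_n, (v <= V)%MS & v != 0.
  have /rowV0Pn[v] := nzV; by exists v.
have sum0P (u : 'rV_n) : (u <= sum0)%MS -> \sum_i u 0 i = 0.
  move=> /sub_kermxP/rowP/(_ 0); rewrite mxE [RHS]mxE => e; rewrite -[RHS]e.
  by apply: eq_bigr => i _; rewrite mxE mulr1.
have v0 := sum0P _ (submx_trans vV sV).
have [[i j] /= nij] : exists ij : 'I_n * 'I_n, v 0 ij.1 != v 0 ij.2.
  apply/existsP; apply: contraNT nzv => /existsPn eqv.
  have {}eqv i j : v 0 i = v 0 j by apply/eqP; have:= eqv (i, j); rewrite negbK.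
  apply/eqP/rowP=> i; rewrite mxE; move: v0.
  rewrite (eq_bigr (fun=> v 0 i)) => [|j _]; last exact: eqv.
  rewrite sumr_const card_ord -mulr_natr => /eqP.
  by rewrite mulf_eq0 pnatr_eq0 => /orP[/eqP //|/eqP n0]; rewrite n0 in n2.
have dV : (d i j <= V)%MS.
  have vt : v - v *m perm_mx (tperm i j) = (v 0 i - v 0 j) *: d i j.
    rewrite -[tperm i j]invgK -col_permE tpermV; apply/rowP=> k; rewrite !mxE /=.
    have ji : (j == i) = false by apply: contraNF nij => /eqP->.
    case: tpermP => [->|->|/eqP ki /eqP kj].
    - by rewrite eqxx eq_sym ji subr0 mulr1.
    - by rewrite eqxx ji sub0r mulrN1 opprB.
    - by rewrite (negPf ki) (negPf kj) !subrr mulr0.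
  have nz : v 0 i - v 0 j != 0 by rewrite subr_eq0.
  rewrite -(eqmx_scale _ nz) -vt addmx_sub // eqmx_opp.
  by apply: (mxmodule_trans (rG := perm_repr) modV _ vV); rewrite inE.
have dklV k l : (d k l <= V)%MS.
  have [->|nkl] := eqVneq k l; first by rewrite /d subrr sub0mx.
  pose s := (tperm i k * tperm (tperm i k j) l)%g.
  have si : s i = k.
    rewrite permM tpermL tpermD // 1?eq_sym // -{1}(tpermL i k).
    by rewrite (inj_eq perm_inj); apply: contraNneq nij => ->.
  have sj : s j = l by rewrite permM tpermL.
  rewrite -si -sj -dP.
  by apply: (mxmodule_trans (rG := perm_repr) modV _ dV); rewrite inE.
apply/row_subP=> r; set u := row r sum0.
have u0 : \sum_k u 0 k = 0 by apply: sum0P; apply: row_sub.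
suff -> : u = \sum_k u 0 k *: d k i.
  by apply: summx_sub => k _; apply: scalemx_sub.
rewrite {1}[u]row_sum_delta; under [RHS]eq_bigr do rewrite scalerBr.
by rewrite sumrB -scaler_suml u0 scale0r subr0.
Qed.

End Standard.

(* ['S_n], with its left-to-right product, is isomorphic to the group of
   permutations under composition through s |-> s^-1, which preserves every
   [Sym B] and hence the Laplacian. *)
Definition laplacianS (R : realType) n (c : {set 'I_n} -> R) :
    {ffun 'S_n -> R[i]} :=
  laplacian (fun B => Sym B) c.

Definition laplacianW (R : realType) (G : finGroupType) n
    (c : {set 'I_n} -> R) : {ffun wreath G n -> R[i]} :=
  laplacian (@wreath_sub G n) c.

(* Main.v *)
Require Import Defs.
From mathcomp Require Import all_boot all_order all_algebra all_fingroup.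
From mathcomp Require Import all_character.
From mathcomp Require Import complex.
From mathcomp Require Import all_classical all_reals ereal.
From mathcomp Require Import ring spectral sesquilinear.

Local Open Scope ring_scope.

(** The nontrivial spectrum of a Laplacian on a regular representation is the
    set of x such that some nonzero real function F of total sum zero satisfies
      \sum_B c_B (F - avg_B F) = x F,
    where avg_B averages F over left translates by the subgroup attached to B
    (Lemmas [eigenfun_of_eigenvalue] and [eigenvalue_of_eigenfun]).  Everything
    else takes place with such eigenfunctions.

    Pulling back along the projection of G wr S_n onto S_n turns eigenfunctions
    of S_n into eigenfunctions of the wreath product, so the bottom of the
    spectrum can only go down ([eigenfun_pullback]).

    Conversely, let F be an eigenfunction on the wreath product with eigenvalue
    x.  For a set K of indices let P_K be the average over G^K.  It commutes with
    the average over W_B, and avg_(W_B) P_K = avg_(W_B) P_(K u B), because in both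
    cases the product of the two subgroups is G^(K u B) S_B.  Choose K maximal
    with P_K F nonzero; then P_K F is again an eigenfunction.
    - If K is everything, P_K F is invariant under the base group G^n, hence is
      the pullback of an eigenfunction of S_n with the same eigenvalue.
    - Otherwise pick a outside K.  For every B containing a, maximality gives
      avg_(W_B) P_K F = avg_(W_B) P_(K u B) F = 0.  Averages are contractions
      for the maximum norm, so evaluating the eigenvalue equation at a point
      where |P_K F| is maximal yields x >= \sum_(B contains a) c_B
      ([eigenvalue_ge]).
    This dichotomy is Lemma [wreath_eigenvalue].

    The second case is harmless because the star of a single vertex bounds the
    gap of S_n from above: the Rayleigh quotient of the Laplacian of the natural
    permutation representation at the vector e_a - (1, ..., 1)/n is at most
    \sum_(B contains a) c_B, so by the spectral theorem some eigenvalue not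
    orthogonal to this vector is as small ([lambda_min_star_RegS_le]). *)

Set Implicit Arguments.
Unset Strict Implicit.
Unset Printing Implicit Defensive.

(* Finite sets take precedence over the classical sets of the same names. *)
Import boot.fintype boot.finset Order.TTheory GRing.Theory Num.Theory.

(** * Averages over subgroups *)

Section Average.
Variables (R : realType) (gT : finGroupType).
Implicit Types (A : {set gT}) (H K : {group gT}) (F : gT -> R).

Definition avg A F (x : gT) : R := (\sum_(g in A) F (g * x)%g) / #|A|%:R.

(** Each element h0 * k0 of the product set has exactly #|H :&: K|
    factorizations, namely (h0 * z) * (z^-1 * k0) for z in H :&: K. *)
Lemma sum_mulg H K (phi : gT -> R) :
  \sum_(h in H) \sum_(k in K) phi (h * k)%g =
  #|H :&: K|%:R * \sum_(m in (H * K)%g) phi m.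
Proof.
rewrite pair_big /= mulr_sumr.
rewrite (partition_big (fun p : gT * gT => p.1 * p.2)%g (mem (H * K)%g)) /=;
  last by move=> p /andP[Hp Kp]; apply: mem_mulg.
apply: eq_bigr => m /mulsgP[h0 k0 Hh Kk ->].
rewrite (eq_bigr (fun=> phi (h0 * k0)%g)) => [|p /andP[_ /eqP->]] //.
rewrite sumr_const mulr_natl; congr (_ *+ _).
pose f z := (h0 * z, z^-1 * k0)%g.
have injf : injective f by move=> y z [/mulgI].
rewrite -(card_imset _ injf); apply: eq_card => -[h k] /=.
rewrite unfold_in /=; apply/andP/imsetP => [[/andP[Hh' Kk'] /eqP e] | [z]].
  exists (h0^-1 * h)%g; last first.
    by rewrite /f invMg invgK mulKVg -mulgA -e mulKg.
  rewrite inE groupM ?groupV //= -(mulgK k (h0^-1 * h)%g) -[(h0^-1 * h * k)%g]mulgA.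
  by rewrite e mulKg groupM ?groupV.
rewrite inE => /andP[Hz Kz] [-> ->].
by rewrite !groupM ?groupV //= mulgA mulgK eqxx.
Qed.

(** Iterated averages depend on the two subgroups only through their product
    set, by the constancy of the number of factorizations; all identities between
    averages over subgroups of the wreath product come from this. *)
Lemma avg_comp H K F : avg K (avg H F) =1 avg (H * K)%g F.
Proof.
move=> x; rewrite /avg.
under eq_bigr do under eq_bigr do rewrite mulgA.
rewrite -mulr_suml exchange_big /= (sum_mulg H K (fun m => F (m * x)%g)).
have nz (L : {group gT}) : #|L|%:R != 0 :> R by rewrite pnatr_eq0 -lt0n cardG_gt0.
have /(congr1 (fun k => k%:R : R)) := mul_cardG H K; rewrite !natrM => e.
have nzHK : #|(H * K)%g|%:R != 0 :> R.
  apply/eqP => e0; move/eqP: e; rewrite e0 mul0r mulf_eq0.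
  by rewrite !(negPf (nz _)).
rewrite -mulrA -invfM e; field; rewrite (nz (H :&: K)%G).
by rewrite nzHK.
Qed.

Lemma avg_comm H K F :
  commute (H : {set gT}) (K : {set gT}) -> avg K (avg H F) =1 avg H (avg K F).
Proof. by move=> HK x; rewrite !avg_comp HK. Qed.

Lemma avg_mull H F h x : h \in H -> avg H F (h * x)%g = avg H F x.
Proof.
move=> Hh; congr (_ / _); rewrite [RHS](reindex_inj (mulIg h)) /=.
by apply: eq_big => [g|g _]; rewrite ?groupMr // mulgA.
Qed.

Lemma avg_set1 F : avg [set 1%g] F =1 F.
Proof. by move=> x; rewrite /avg big_set1 cards1 divr1 mul1g. Qed.

Lemma sum_avg A F : \sum_x F x = 0 -> \sum_x avg A F x = 0.
Proof.
move=> F0; rewrite -mulr_suml exchange_big big1 ?mul0r // => g _.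
by rewrite -[RHS]F0 [RHS](reindex_inj (mulgI g)).
Qed.

Lemma norm_avg A F (M : R) : 0 <= M -> (forall x, `|F x| <= M) ->
  forall x, `|avg A F x| <= M.
Proof.
move=> M0 leFM x; rewrite normrM normfV normr_nat.
have [->|nz] := eqVneq #|A| 0%N; first by rewrite invr0 mulr0.
rewrite ler_pdivrMr ?ltr0n ?lt0n // mulr_natr -sumr_const.
by rewrite (le_trans (ler_norm_sum _ _ _)) // ler_sum.
Qed.

End Average.

(** * Eigenfunctions of weighted Laplacians *)

Section Eigenfunctions.
Variables (R : realType) (gT : finGroupType) (n : nat).
Variables (H : {set 'I_n} -> {set gT}) (c : {set 'I_n} -> R).
Implicit Types (F : gT -> R) (x : R).

(** The group algebra element [laplacian H c], acting on functions by left
    translation. *)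
Definition lap_fun F h : R := \sum_B c B * (F h - avg (H B) F h).

Record eigenfun x F : Prop := Eigenfun {
  eigenfun_neq0 : exists h, F h != 0;
  eigenfun_sum : \sum_h F h = 0;
  eigenfunE : forall h, lap_fun F h = x * F h }.

Lemma lap_fun_avg A F :
  (forall B, avg (H B) (avg A F) =1 avg A (avg (H B) F)) ->
  lap_fun (avg A F) =1 avg A (lap_fun F).
Proof.
move=> comm h; rewrite [RHS]/avg /lap_fun exchange_big mulr_suml.
apply: eq_bigr => B _; rewrite comm /avg.
by rewrite -mulr_sumr -mulrA sumrB mulrBl.
Qed.

(** A maximum principle.  At a point h0 where |F| is maximal, multiplying by the
    sign of F h0 gives x |F h0| = \sum_B c_B (|F h0| - sg (F h0) avg_B F h0).
    Averages are bounded by |F h0|, so all terms are nonnegative, and those in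
    which the average vanishes equal c_B |F h0|. *)
Lemma eigenvalue_ge x F (P : pred {set 'I_n}) :
  (forall B, 0 <= c B) -> (exists h, F h != 0) ->
  (forall h, lap_fun F h = x * F h) ->
  (forall B, P B -> forall h, avg (H B) F h = 0) ->
  \sum_(B | P B) c B <= x.
Proof.
move=> c0 [h1 nz1] eigF killF.
pose h0 := [arg max_(h > h1) `|F h|]%O.
have maxF h : `|F h| <= `|F h0|.
  by rewrite /h0; case: arg_maxP => // h' _; apply.
have M0 : 0 < `|F h0| by rewrite (lt_le_trans _ (maxF h1)) ?normr_gt0.
rewrite -(ler_pM2r M0).
have -> : x * `|F h0| =
    \sum_B c B * (`|F h0| - Num.sg (F h0) * avg (H B) F h0).
  rewrite normrEsg mulrCA -eigF mulr_sumr; apply: eq_bigr => B _.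
  by rewrite mulrCA mulrBr.
rewrite mulr_suml big_mkcond ler_sum // => B _; case: ifP => [PB|_].
  by rewrite killF // mulr0 subr0.
rewrite mulr_ge0 // subr_ge0 (le_trans (ler_norm _)) // normrM normr_sg.
have -> : F h0 != 0 by rewrite -normr_gt0.
by rewrite mul1r norm_avg.
Qed.

End Eigenfunctions.

(** * Supported subgroups of the wreath product *)

Section WreathAverages.
Variables (G : finGroupType) (n : nat).
Implicit Types (B K L : {set 'I_n}) (u v w : wreath G n).

(** One family containing both the base subgroups G^L (as [supp_sub set0 L]) and
    the subgroups [wreath_sub] (as [supp_sub B B]); it is also closed under the
    products that occur between them. *)
Definition supp_sub B L : {set wreath G n} :=
  [set w | (wperm w \in Sym B) &&
           [forall i, (i \notin L) ==> (wbase w i == 1%g)]].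

Lemma supp_subP B L w : reflect
  (wperm w \in Sym B /\ forall i, i \notin L -> wbase w i = 1%g) (w \in supp_sub B L).
Proof.
rewrite [w \in _]inE; apply: (iffP andP) => -[wB wL]; split=> //.
  by move=> i iL; apply/eqP; move/forallP/(_ i)/implyP: wL; apply.
by apply/forallP=> i; apply/implyP=> iL; rewrite wL.
Qed.

Lemma Sym_fix B (s : 'S_n) i : s \in Sym B -> i \notin B -> s i = i.
Proof. by rewrite inE => sB iB; apply: out_perm sB iB. Qed.

Lemma supp_sub_group_set B L : B \subset L -> group_set (supp_sub B L).
Proof.
move=> sBL; apply/group_setP; split.
  by apply/supp_subP; split=> [|i _]; rewrite /= ?group1 ?ffunE.
move=> u v /supp_subP[uB uL] /supp_subP[vB vL]; apply/supp_subP; split=> [|i iL] /=.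
  exact: groupM vB uB.
have iB : i \notin B by apply: contra iL => /(subsetP sBL).
by rewrite ffunE uL // mul1g (Sym_fix (B := B)) ?groupV // vL.
Qed.

Canonical base_group L := Group (supp_sub_group_set (sub0set L)).

Lemma wreath_sub_group_set B : group_set (wreath_sub G B).
Proof. by apply: (@supp_sub_group_set B B). Qed.

Canonical wreath_sub_group B := Group (wreath_sub_group_set B).

(** To factor w as an element of G^K times an element of W_B, the base
    coordinates in B go to the second factor, the others to the first. *)
Lemma supp_sub_mul B K : (supp_sub set0 K * wreath_sub G B)%g = supp_sub B (K :|: B).
Proof.
apply/setP=> w; apply/mulsgP/supp_subP => [[u v] | [wB wKB]].
  move=> /supp_subP[u0 uK] /supp_subP[vB vKB] ->; split=> [|i].
    apply: groupM vB _; move: u0; rewrite !inE => u0.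
    exact: subset_trans u0 (sub0set B).
  rewrite inE negb_or => /andP[iK iB] /=; rewrite ffunE uK // mul1g.
  have -> : (wperm u)^-1%g i = i by apply: (Sym_fix (B := set0)); rewrite ?groupV // inE.
  exact: vKB.
exists (Wreath [ffun i => if i \in B then 1%g else wbase w i] 1%g)
       (Wreath [ffun i => if i \in B then wbase w i else 1%g] (wperm w)).
- apply/supp_subP; split=> [|i iK] /=; first exact: group1.
  by rewrite ffunE; case: ifP => // iB; rewrite wKB // inE iB negb_or iK.
- by apply/supp_subP; split=> //= i iB; rewrite ffunE (negPf iB).
case: w wB wKB => g s /= _ _; congr Wreath; rewrite ?mulg1 //=.
apply/ffunP=> i; rewrite !ffunE invg1 perm1; case: ifP; by rewrite ?mul1g ?mulg1.
Qed.

(** Two subgroups permute as soon as their product is a group. *)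
Lemma base_commute B K : commute (supp_sub set0 K) (wreath_sub G B).
Proof.
apply: (elimT (@comm_group_setP _ (base_group K) (wreath_sub_group B))).
by rewrite supp_sub_mul supp_sub_group_set // subsetUr.
Qed.

Lemma supp_sub00 : supp_sub set0 set0 = [set 1%g].
Proof.
apply/setP=> -[g s]; apply/supp_subP/set1P => [[/= s0 g0]|[-> ->] /=].
  congr Wreath; first by apply/ffunP=> i; rewrite ffunE g0 ?inE.
  by apply/permP=> i; rewrite perm1 (Sym_fix s0) ?inE.
by split=> [|i _]; rewrite ?group1 ?ffunE.
Qed.

Section Functions.
Variable R : realType.
Implicit Types (F : wreath G n -> R) (f : 'S_n -> R).

Lemma avg_wreath_base F B K :
  avg (wreath_sub G B) (avg (supp_sub set0 K) F) =1 avg (supp_sub B (K :|: B)) F.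
Proof. by move=> w; rewrite (avg_comp (base_group K)) supp_sub_mul. Qed.

(** W_B contains G^B, so averaging over W_B does not notice whether the base
    coordinates in B have been averaged before. *)
Lemma avg_wreath_absorb F B K :
  avg (wreath_sub G B) (avg (supp_sub set0 K) F) =1
  avg (wreath_sub G B) (avg (supp_sub set0 (K :|: B)) F).
Proof. by move=> w; rewrite !avg_wreath_base -setUA setUid. Qed.

Lemma sum_supp_sub B L (phi : 'S_n -> R) :
  \sum_(w in supp_sub B L) phi (wperm w) =
  #|[set g : {ffun 'I_n -> G} | [forall i, (i \notin L) ==> (g i == 1%g)]]|%:R *
  \sum_(s in Sym B) phi s.
Proof.
have bij_wreath : {on [pred w | w \in supp_sub B L], bijective (@wreath_of_pair G n)}.
  by exists (@pair_of_wreath G n) => w _; [case: w | rewrite pair_of_wreathK].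
rewrite (reindex _ bij_wreath) /= -sum1_card natr_sum big_distrlr pair_big /=.
apply: eq_big => [[g s]|[g s] _] /=; last by rewrite mul1r.
by rewrite [LHS]inE [X in _ = X && _]inE andbC.
Qed.

Lemma card_supp_sub_neq0 B L : B \subset L -> #|supp_sub B L|%:R != 0 :> R.
Proof.
move=> sBL; rewrite pnatr_eq0 -lt0n.
exact: (cardG_gt0 (Group (supp_sub_group_set sBL))).
Qed.

(** The fibres of the projection to S_n all have the same cardinality, namely
    the number of base elements supported in L. *)
Lemma avg_wperm B L (phi : 'S_n -> R) : B \subset L ->
  (\sum_(w in supp_sub B L) phi (wperm w)) / #|supp_sub B L|%:R =
  (\sum_(s in Sym B) phi s) / #|Sym B|%:R.
Proof.
move=> sBL; have nz := card_supp_sub_neq0 sBL.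
have cardE : #|supp_sub B L|%:R =
    #|[set g : {ffun 'I_n -> G} | [forall i, (i \notin L) ==> (g i == 1%g)]]|%:R *
    #|Sym B|%:R :> R.
  by rewrite -[in LHS]sum1_card natr_sum (sum_supp_sub B L (fun=> 1)) sumr_const.
move: nz; rewrite sum_supp_sub cardE mulf_eq0 negb_or => /andP[nzN nzS].
by rewrite -mulf_div divff // mul1r.
Qed.

(** The inverse turns [wperm], which reverses products because 'S_n composes
    from left to right, into a homomorphism. *)
Definition pullback f w : R := f (wperm w)^-1%g.

Lemma avg_pullback f B w :
  avg (wreath_sub G B) (pullback f) w = avg (Sym B) f (wperm w)^-1%g.
Proof.
have -> : avg (Sym B) f (wperm w)^-1%g =
    (\sum_(s in Sym B) f (s^-1 * (wperm w)^-1)%g) / #|Sym B|%:R.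
  congr (_ / _); rewrite (reindex_inj invg_inj); apply: eq_bigl => s.
  exact: groupV.
rewrite -(avg_wperm (fun s => f (s^-1 * (wperm w)^-1)%g) (subxx B)).
by congr (_ / _); apply: eq_bigr => u _; rewrite /pullback /= invMg.
Qed.

Lemma lap_pullback c f w :
  lap_fun (@wreath_sub G n) c (pullback f) w =
  lap_fun (fun B => Sym B) c f (wperm w)^-1%g.
Proof. by apply: eq_bigr => B _; rewrite avg_pullback. Qed.

End Functions.
End WreathAverages.

(** * Eigenfunctions of the wreath product *)

Section WreathEigenfunctions.
Variables (R : realType) (G : finGroupType) (n : nat) (c : {set 'I_n} -> R).
Implicit Types (F : wreath G n -> R) (f : 'S_n -> R) (x : R).

Let eigenfunS := eigenfun (fun B : {set 'I_n} => Sym B) c.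
Let eigenfunW := eigenfun (@wreath_sub G n) c.

Lemma sum_pullback f :
  (\sum_(w : wreath G n) pullback f w == 0) = (\sum_s f s == 0).
Proof.
have inS (s : 'S_n) : s \in Sym [set: 'I_n].
  by rewrite inE; apply/subsetP=> i; rewrite inE.
have inT (w : wreath G n) : w \in supp_sub G [set: 'I_n] [set: 'I_n].
  by apply/supp_subP; split=> // i; rewrite inE.
have := avg_wperm G (fun s => f s^-1%g) (subxx [set: 'I_n]).
rewrite (eq_bigl xpredT) // [X in _ = X / _ -> _](eq_bigl xpredT) //.
have -> : \sum_s f s^-1%g = \sum_s f s by rewrite [RHS](reindex_inj invg_inj).
have nzT := card_supp_sub_neq0 G R (subxx [set: 'I_n]).
have nzS : #|Sym [set: 'I_n]|%:R != 0 :> R by rewrite pnatr_eq0 -lt0n cardG_gt0.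
move/(canRL (divfK nzT)); rewrite -/(pullback f _) => ->.
by rewrite !mulf_eq0 invr_eq0 (negPf nzT) (negPf nzS) !orbF.
Qed.

Lemma eigenfun_pullback x f :
  eigenfunS x f <-> eigenfunW x (pullback f).
Proof.
pose lift s : wreath G n := Wreath [ffun=> 1%g] s^-1%g.
have liftE s : pullback f (lift s) = f s by rewrite /pullback /= invgK.
split=> -[[h nz] /eqP sum0 eigF]; split.
- by exists (lift h); rewrite liftE.
- by apply/eqP; rewrite sum_pullback.
- by move=> w; rewrite lap_pullback eigF.
- by exists (wperm h)^-1%g.
- by apply/eqP; rewrite -sum_pullback.
by move=> s; have := eigF (lift s); rewrite lap_pullback liftE /= invgK.
Qed.

(** The two cases are separated by a maximal K for which the average P K over
    G^K does not kill F.  If a lies outside K, then for every B containing a the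
    set K :|: B is larger than K, so the average over W_B kills P K. *)
Lemma wreath_eigenvalue x F : (forall B, 0 <= c B) -> eigenfunW x F ->
  (exists f, eigenfunS x f) \/ (exists a : 'I_n, \sum_(B : {set 'I_n} | a \in B) c B <= x).
Proof.
move=> c0 [[h nzF] sumF eigF].
pose P K := avg (supp_sub G set0 K) F.
have P0 : [exists w, P set0 w != 0].
  by apply/existsP; exists h; rewrite /P supp_sub00 avg_set1.
have [K /maxsetP[/existsP[w nzw] maxK] _] :=
  @maxset_exists _ (fun K => [exists w, P K w != 0]) _ P0.
have eigP w' : lap_fun (@wreath_sub G n) c (P K) w' = x * P K w'.
  rewrite lap_fun_avg => [|B u].
    by rewrite /avg (eq_bigr _ (fun g _ => eigF _)) -mulr_sumr mulrA.
  exact: (@avg_comm _ _ (base_group G K) (wreath_sub_group G B) F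
    (base_commute G B K) u).
(* If K is everything, P K is constant on the cosets of the base group. *)
have [KT | /subsetPn[a _ aK]] := boolP ([set: 'I_n] \subset K).
  left; exists (fun s => P K (Wreath [ffun=> 1%g] s^-1%g)); apply/eigenfun_pullback.
  have PE : pullback (fun s => P K (Wreath [ffun=> 1%g] s^-1%g)) = P K.
    apply/funext => -[g s]; rewrite /pullback /= invgK.
    have gK : Wreath g 1%g \in base_group G K.
      by apply/supp_subP; split=> [|i]; rewrite ?group1 // (subsetP KT) ?inE.
    rewrite /P -(avg_mull F _ gK); congr (avg _ _ _); congr Wreath.
      by apply/ffunP=> i; rewrite !ffunE mulg1.
    by rewrite /= mulg1.
  by rewrite PE; split=> //; [exists w | apply: sum_avg].
right; exists a; apply: eigenvalue_ge eigP _ => //; first by exists w.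
move=> B aB w'; rewrite avg_wreath_absorb.
rewrite /avg big1 ?mul0r // => g _; apply: contraNeq aK => nz.
rewrite -(maxK (K :|: B)) ?subsetUl ?inE ?aB ?orbT //.
by apply/existsP; exists (g * w')%g.
Qed.

End WreathEigenfunctions.

(** * The nontrivial spectrum of a regular representation *)

Section RegularSpectrum.
Local Open Scope complex_scope.
Variables (R : realType) (gT : finGroupType) (n : nat).
Variables (H : {set 'I_n} -> {set gT}) (c : {set 'I_n} -> R).
Local Notation C := R[i].
Local Notation reprG := (mx_representation C [set: gT]%G).
Local Notation lap := (laplacian H c).

Lemma galg_mx_laplacian d (rho : reprG d) :
  galg_mx lap rho =
  \sum_B (c B)%:C *: (1%:M - (#|H B|%:R^-1)%:C *: \sum_(g in H B) rho g).
Proof.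
rewrite /galg_mx; transitivity (\sum_(g : gT) \sum_B
   (c B)%:C *: ((g == 1%g)%:R *: rho g - ((g \in H B)%:R / #|H B|%:R) *: rho g)).
  apply: eq_bigr => g _; rewrite /laplacian sum_ffunE scaler_suml.
  by apply: eq_bigr => B _; rewrite !ffunE -scalerBl scalerA.
rewrite exchange_big; apply: eq_bigr => B _; rewrite -scaler_sumr sumrB.
congr (_ *: (_ - _)).
  rewrite (bigD1 1%g) //= eqxx scale1r repr_mx1 big1 ?addr0 // => g ng.
  by rewrite (negPf ng) scale0r.
rewrite scaler_sumr [RHS]big_mkcond; apply: eq_bigr => g _.
rewrite fmorphV rmorph_nat; case: ifP => _; rewrite ?mul1r //.
by rewrite mul0r scale0r.
Qed.

(** Since the eigenvalues considered are real and the Laplacian has real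
    coefficients, taking real parts of matrix coefficients preserves the
    eigenvalue equation and leads to functions with values in an ordered field,
    where the maximum principle applies. *)
Section MatrixCoefficient.
Variables (d : nat) (rho : reprG d) (u : 'rV[C]_d) (t : 'cV[C]_d).

Definition re_form (A : 'M[C]_d) : R := complex.Re ((u *m A *m t) 0 0).

Lemma re_formD A1 A2 : re_form (A1 + A2) = re_form A1 + re_form A2.
Proof.
rewrite /re_form mulmxDr mulmxDl mxE.
by case: (fun_of_matrix _ _ _) => y1 z1; case: (fun_of_matrix _ _ _).
Qed.

Lemma re_formZ (r : R) A : re_form (r%:C *: A) = r * re_form A.
Proof.
rewrite /re_form -scalemxAr -scalemxAl mxE.
by case: (fun_of_matrix _ _ _) => y z /=; rewrite mul0r subr0.
Qed.

Lemma re_formB A1 A2 : re_form (A1 - A2) = re_form A1 - re_form A2.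
Proof.
have -> : A1 - A2 = A1 + (-1 : R)%:C *: A2 by rewrite rmorphN1 scaleN1r.
by rewrite re_formD re_formZ mulN1r.
Qed.

Lemma re_form_sum (I : finType) (P : pred I) (A : I -> 'M[C]_d) :
  re_form (\sum_(i | P i) A i) = \sum_(i | P i) re_form (A i).
Proof.
have re0 : re_form 0 = 0 by rewrite /re_form mulmx0 mul0mx mxE.
exact: (big_morph re_form re_formD re0).
Qed.

(** If u is an eigenvector, then replacing h by g h in u rho(h) t inserts
    rho(g) right after u, so that the Laplacian acts on the coefficient function
    through u. *)
Lemma eigenfun_coef x :
  u *m galg_mx lap rho = x%:C *: u -> re_form 1%:M != 0 ->
  u *m (\sum_g rho g) *m t = 0 -> eigenfun H c x (fun h => re_form (rho h)).
Proof.
move=> eigu nz sum0; split.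
- by exists 1%g; rewrite repr_mx1.
- by rewrite -re_form_sum /re_form sum0 mxE.
move=> h; rewrite -re_formZ /re_form -scalemxAr scalemxAl -eigu.
rewrite -[u *m _ *m rho h]mulmxA -/(re_form _) galg_mx_laplacian mulmx_suml re_form_sum.
apply: eq_bigr => B _; rewrite -scalemxAl re_formZ mulmxBl mul1mx re_formB.
rewrite -scalemxAl re_formZ mulmx_suml re_form_sum.
congr (_ * (_ - _)); rewrite [RHS]mulrC; congr (_ / _).
by apply: eq_bigr => g _; rewrite repr_mxM ?inE.
Qed.

End MatrixCoefficient.

Lemma fixed_line_module d (rho : reprG d) (v : 'rV[C]_d) :
  (forall g, v *m rho g = v) -> mxmodule rho <<v>>%MS.
Proof.
move=> fixv; apply/mxmoduleP=> g _.
by rewrite genmxE (eqmxMr _ (genmxE v)) fixv submx_refl.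
Qed.

Lemma fixed_line_triv d (rho : reprG d) (v : 'rV[C]_d)
    (modv : mxmodule rho <<v>>%MS) :
  v != 0 -> (forall g, v *m rho g = v) ->
  mx_rsim (submod_repr modv) (triv_repr R gT).
Proof.
move=> nzv fixv; apply: mx_rsim_sym.
exists (in_submod <<v>>%MS v).
- by rewrite genmxE rank_rV nzv.
- by rewrite /row_free mxrank_in_submod ?genmxE // rank_rV nzv.
move=> g _; rewrite -(in_submodJ modv) ?genmxE //= fixv.
by rewrite mul1mx.
Qed.

(** The vector u \sum_g rho(g) is fixed by the group; were it nonzero, it would
    span a trivial component. *)
Lemma sum_no_trivial d (rho : reprG d) (u : 'rV[C]_d) :
  no_trivial_component rho -> u *m (\sum_g rho g) = 0.
Proof.
move=> notriv; apply/eqP/negPn/negP; set v := u *m _ => nzv.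
have fixv g : v *m rho g = v.
  rewrite /v -mulmxA mulmx_suml; congr (_ *m _).
  rewrite [RHS](reindex_inj (mulIg g)); apply: eq_bigr => h _.
  by rewrite repr_mxM ?inE.
have modv : mxmodule rho <<v>>%MS by apply: fixed_line_module.
exact: (notriv _ modv (fixed_line_triv modv nzv fixv)).
Qed.

(** For t dual to a nonzero coordinate of u, the coefficient at the unit is 1,
    and the total sum of the coefficient function vanishes by
    [sum_no_trivial]. *)
Lemma eigenfun_of_eigenvalue d (rho : reprG d) x :
  no_trivial_component rho -> eigenvalue (galg_mx lap rho) x%:C ->
  exists F, eigenfun H c x F.
Proof.
move=> notriv /eigenvalueP[u eigu nzu].
have [j nzj] : exists j, u 0 j != 0 by apply/rV0Pn.
exists (fun h => re_form u ((u 0 j)^-1 *: delta_mx j 0) (rho h)).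
apply: eigenfun_coef eigu _ _; last by rewrite sum_no_trivial // mul0mx.
by rewrite /re_form mulmx1 -scalemxAr -colE 2!mxE mulVf // oner_eq0.
Qed.

Definition sum_zero : 'M[C]_#|gT| := kermx (const_mx 1 : 'cV_#|gT|).

Lemma Reg_const g : Reg R gT g *m (const_mx 1 : 'cV_#|gT|) = const_mx 1.
Proof.
apply/matrixP=> i j; rewrite !mxE (bigD1 (enum_rank (g^-1 * enum_val i)%g)) //=.
rewrite !mxE enum_rankK mulKVg eqxx mul1r big1 ?addr0 // => k nk.
rewrite !mxE mulr1; case: eqP => // e; case/eqP: nk.
by rewrite e mulKg enum_valK.
Qed.

Lemma mul_Reg (v : 'rV[C]_#|gT|) g j :
  (v *m Reg R gT g) 0 j = v 0 (enum_rank (g * enum_val j)%g).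
Proof.
rewrite mxE (bigD1 (enum_rank (g * enum_val j)%g)) //= !mxE enum_rankK eqxx mulr1.
rewrite big1 ?addr0 // => k nk; rewrite !mxE.
case: eqP => [e|_]; last by rewrite mulr0.
by case/eqP: nk; rewrite -e enum_valK.
Qed.

Lemma sum_zeroP (v : 'rV[C]_#|gT|) :
  reflect (\sum_g v 0 (enum_rank g) = 0) (v <= sum_zero)%MS.
Proof.
have e : (v *m (const_mx 1 : 'cV_#|gT|)) 0 0 = \sum_g v 0 (enum_rank g).
  rewrite mxE (reindex _ (onW_bij _ (@enum_rank_bij gT))) /=.
  by apply: eq_bigr => g _; rewrite mxE mulr1.
apply: (iffP sub_kermxP) => [v0|s0]; first by rewrite -e v0 mxE.
by apply/matrixP=> i j; rewrite !ord1 e s0 mxE.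
Qed.

Lemma sum_zero_module : mxmodule (Reg R gT) sum_zero.
Proof.
apply/mxmoduleP=> g _.
by rewrite sub_kermx -mulmxA Reg_const mulmx_ker.
Qed.

(** The regular representation on functions of total sum zero, which is the
    nontrivial part of the regular representation. *)
Definition Reg0 := submod_repr sum_zero_module.

Let one : 'rV[C]_#|gT| := const_mx 1.

Lemma one_neq0 : one != 0.
Proof.
apply/eqP=> /rowP/(_ (enum_rank 1%g)); rewrite !mxE => /eqP.
by rewrite oner_eq0.
Qed.

Lemma one_Reg g : one *m Reg R gT g = one.
Proof. by apply/rowP=> j; rewrite mul_Reg !mxE. Qed.

Lemma card_neq0 : #|gT|%:R != 0 :> C.
Proof. by rewrite pnatr_eq0 -lt0n; apply/card_gt0P; exists 1%g. Qed.

(** A vector fixed by all left translations is constant, so it is zero if its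
    coordinates add up to zero. *)
Lemma sum_zero_no_trivial : no_trivial_component Reg0.
Proof.
move=> U modU /mx_rsim_sym[B rankU freeB homB].
pose v : 'rV[C]_#|gT| := val_submod (val_submod B).
have nzv : v != 0.
  by rewrite !val_submod_eq0 -mxrank_eq0 (eqP freeB).
have fixv g : v *m Reg R gT g = v.
  rewrite -(val_submodJ sum_zero_module) ?inE // -(val_submodJ modU) ?inE //.
  by rewrite -homB ?inE // mul1mx.
have v1 j : v 0 j = v 0 (enum_rank 1%g).
  by rewrite -{1}(fixv (enum_val j)^-1%g) mul_Reg mulVg.
have /sum_zeroP : (v <= sum_zero)%MS by apply: val_submodP.
rewrite (eq_bigr (fun=> v 0 (enum_rank 1%g))) // sumr_const -mulr_natr => /eqP.
rewrite mulf_eq0 (negPf card_neq0) orbF => /eqP v10.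
by case/eqP: nzv; apply/rowP=> j; rewrite v1 v10 mxE.
Qed.

(** The regular representation is the direct sum of [Reg0] and the line of
    constants. *)
Lemma Reg0_nontrivial_part : nontrivial_part (Reg R gT) Reg0.
Proof.
split; first exact: sum_zero_no_trivial.
exists 1%N; have mod1 := fixed_line_module one_Reg.
apply: mx_rsim_trans (mx_rsim_sym (rsim_submod1 (mxmodule1 _) (eqmx_refl _))) _.
have cap0 : (sum_zero :&: <<one>> = 0)%MS.
  apply/eqP; rewrite -submx0; apply/row_subP=> i.
  set v := row i _; have : (v <= sum_zero :&: <<one>>)%MS by apply: row_sub.
  rewrite sub_capmx genmxE => /andP[/sum_zeroP v0 /sub_rVP[a va]]; move: v0.
  rewrite va (eq_bigr (fun=> a)) => [|g _]; last by rewrite !mxE mulr1.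
  rewrite sumr_const -mulr_natr => /eqP; rewrite mulf_eq0 (negPf card_neq0) orbF.
  by move/eqP->; rewrite scale0r sub0mx.
apply: (mx_rsim_dadd (V := <<one>>%MS) (modU := sum_zero_module) (modV := mod1)
  (rU := Representation Reg0)) _ _ _ _ => /=.
- apply/eqmxP; rewrite submx1; apply/row_subP=> i; set v := row i _.
  pose a := (\sum_g v 0 (enum_rank g)) / #|gT|%:R.
  rewrite -[v](subrK (a *: one)) addmx_sub_adds //; last first.
    by rewrite scalemx_sub // genmxE.
  apply/sum_zeroP; rewrite (eq_bigr (fun g => v 0 (enum_rank g) - a)) => [|g _].
    by rewrite sumrB sumr_const -mulr_natr divfK ?card_neq0 // subrr.
  by rewrite !mxE mulr1.
- exact/mxdirect_addsP.
- exact: mx_rsim_refl.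
apply: (mx_rsim_dsum (modU := fun=> mod1)) => [||_].
- by rewrite big_ord_recl big_ord0; apply: addsmx0.
- apply/mxdirect_sumsP=> i _; rewrite big_pred0 ?capmx0 // => j.
  by rewrite !ord1 eqxx.
exact: fixed_line_triv one_neq0 one_Reg.
Qed.

Lemma eigenvalue_of_eigenfun F x :
  eigenfun H c x F -> eigenvalue (galg_mx lap Reg0) x%:C.
Proof.
case=> -[h nzF] sumF eigF; pose v : 'rV[C]_#|gT| := \row_j (F (enum_val j))%:C.
have v0 : (v <= sum_zero)%MS.
  apply/sum_zeroP; rewrite (eq_bigr (fun g => (F g)%:C)) => [|g _].
    by rewrite -rmorph_sum sumF rmorph0.
  by rewrite mxE enum_rankK.
have eigv : v *m galg_mx lap (Reg R gT) = x%:C *: v.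
  apply/rowP=> j; rewrite galg_mx_laplacian mulmx_sumr summxE !mxE.
  rewrite -rmorphM -eigF rmorph_sum; apply: eq_bigr => B _.
  rewrite -scalemxAr mxE mulmxBr mulmx1 mxE [v 0 j]mxE mxE -scalemxAr mxE.
  rewrite mulmx_sumr summxE rmorphM rmorphB [avg _ _ _]mulrC rmorphM rmorph_sum.
  congr (_ * (_ - _ * _)); apply: eq_bigr => g _.
  by rewrite mul_Reg mxE enum_rankK.
apply/eigenvalueP; exists (in_submod sum_zero v).
  rewrite -linearZ /= -eigv /galg_mx !mulmx_sumr linear_sum /=.
  apply: eq_bigr => g _; rewrite -!scalemxAr linearZ /=.
  by rewrite (in_submodJ sum_zero_module).
rewrite -(val_submod_eq0 (U := sum_zero)) in_submodK //.
apply/eqP=> /rowP/(_ (enum_rank h)); rewrite !mxE enum_rankK => /eqP.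
by rewrite fmorph_eq0 (negPf nzF).
Qed.

(** Real eigenfunctions bound [lambda_min_star] from above because each of them
    contributes to the spectrum of [Reg0]; in the next lemma they bound it from
    below because nontrivial parts contain no trivial component. *)
Lemma lambda_min_star_Reg_le F x :
  eigenfun H c x F -> (lambda_min_star lap (Reg R gT) <= x%:E)%E.
Proof.
move=> eigF; apply: (@le_trans _ _ (lambda_min lap Reg0)).
  apply: ereal_inf_lbound; exists (\rank sum_zero), Reg0.
  by split=> //; apply: Reg0_nontrivial_part.
by apply: ereal_inf_lbound; exists x => //; apply: eigenvalue_of_eigenfun eigF.
Qed.

Lemma le_lambda_min_star_Reg (m : \bar R) :
  (forall x F, eigenfun H c x F -> (m <= x%:E)%E) ->
  (m <= lambda_min_star lap (Reg R gT))%E.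
Proof.
move=> mle; apply/ereal_infP => _ [d [rho [[notriv _] ->]]].
apply/ereal_infP => _ [x eigx <-].
by have [F] := eigenfun_of_eigenvalue notriv eigx; apply: mle.
Qed.

End RegularSpectrum.

(** * A vertex bound from the permutation representation *)

Section Rayleigh.
Local Open Scope complex_scope.
Local Open Scope sesquilinear_scope.
Variables (R : realType) (n : nat).
Local Notation toC := (map_mx (real_complex R)).

(** Diagonalize A in an orthonormal basis and let y be the coordinates of v.
    The hypothesis reads \sum_i (D_i - w) |y_i|^2 <= 0, so some i has y_i nonzero
    and D_i <= w.  The overlap with v is kept in the conclusion because it is
    what later excludes the constant eigenvector. *)
Lemma rayleigh_eigenvalue (A : 'M[R]_n) (v : 'rV[R]_n) (w : R) :
  A^T = A -> v != 0 -> (v *m A *m v^T) 0 0 <= w * (v *m v^T) 0 0 ->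
  exists mu (u : 'rV[R[i]]_n),
    [/\ mu <= w, u *m toC A = mu%:C *: u & u *m toC v^T != 0].
Proof.
move=> symA nzv le_w.
have conjR (r : R) : Num.conj (r%:C) = r%:C by apply/CrealP; rewrite complex_real.
have herm : toC A \is hermsymmx.
  apply: realsym_hermsym.
    apply/is_hermitianmxP; rewrite expr0 scale1r map_mx_id //.
    by rewrite map_trmx symA.
  by apply/mxOverP=> i j; rewrite mxE complex_real.
have /hermitian_normalmx/orthomx_spectralP := herm.
have := hermitian_spectral_diag_real herm.
have := spectral_unitarymx (toC A).
set P := spectralmx _; set D := spectral_diag _ => Punit /mxOverP Dreal defA.
have PP : P^t* *m P = 1%:M.
  by rewrite -invmx_unitary // mulVmx // unitarymx_unit.
pose y : 'rV[R[i]]_n := toC v *m P^t*.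
have yP : y *m P = toC v by rewrite -mulmxA PP mulmx1.
have zE i : (P *m toC v^T) i 0 = Num.conj (y 0 i).
  rewrite !mxE rmorph_sum; apply: eq_bigr => j _.
  by rewrite !mxE rmorphM /= conjCK conjR mulrC.
have PA : P *m toC A = diag_mx D *m P.
  by rewrite {1}defA !mulmxA mulmxV ?mul1mx // unitarymx_unit.
have normE : ((v *m v^T) 0 0)%:C = \sum_i `|y 0 i| ^+ 2.
  transitivity ((toC v *m toC v^T) 0 0); first by rewrite -map_mxM [RHS]mxE.
  rewrite -yP -mulmxA mxE; apply: eq_bigr => i _.
  by rewrite zE -normCK.
have formE : ((v *m A *m v^T) 0 0)%:C = \sum_i D 0 i * `|y 0 i| ^+ 2.
  transitivity ((toC v *m toC A *m toC v^T) 0 0); first by rewrite -!map_mxM [RHS]mxE.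
  rewrite -yP -(mulmxA y) PA !mulmxA -mulmxA mxE. apply: eq_bigr => i _.
  by rewrite zE mul_mx_diag mxE mulrAC -normCK mulrC.
have [i nzy leD] : exists2 i, y 0 i != 0 & D 0 i <= w%:C.
  apply/exists_inP; apply: contraT => /exists_inPn gtD.
  have {}gtD i : y 0 i != 0 -> w%:C < D 0 i.
    by move=> /gtD; rewrite real_ltNge // complex_real.
  have ge0 i : true -> 0 <= (D 0 i - w%:C) * `|y 0 i| ^+ 2.
    have [->|/gtD/ltW leD _] := eqVneq (y 0 i) 0; first by rewrite normr0 expr0n mulr0.
    by rewrite mulr_ge0 ?subr_ge0 // exprn_ge0.
  have le0 : \sum_i (D 0 i - w%:C) * `|y 0 i| ^+ 2 <= 0.
    under eq_bigr do rewrite mulrBl.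
    rewrite sumrB -mulr_sumr -normE -formE subr_le0 -rmorphM.
    by rewrite lecR.
  have : \sum_i (D 0 i - w%:C) * `|y 0 i| ^+ 2 = 0.
    by apply/le_anti; rewrite le0 sumr_ge0.
  move=> /(psumr_eq0P ge0) eq0; case/eqP: nzv.
  apply: (map_mx_inj (f := real_complex R)).
  rewrite -yP map_mx0; suff -> : y = 0 by rewrite mul0mx.
  apply/rowP=> i; rewrite [RHS]mxE; apply/eqP; apply: contraT => nzy.
  have /eqP := eq0 i isT; rewrite mulf_eq0 subr_eq0 expf_eq0 normr_eq0 (negPf nzy).
  by rewrite gt_eqF ?gtD.
have [Di_real] : D 0 i \is Num.real by [].
exists (complex.Re (D 0 i)), (row i P); split.
- by rewrite -lecR RRe_real.
- rewrite RRe_real // -row_mul PA; apply/rowP=> j.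
  by rewrite mul_diag_mx !mxE.
apply: contraNneq nzy => /matrixP/(_ 0 0).
by rewrite -row_mul [RHS]mxE mxE zE => /eqP; rewrite conjC_eq0.
Qed.

End Rayleigh.

Section StandardBound.
Local Open Scope complex_scope.
Variables (R : realType) (n : nat) (c : {set 'I_n} -> R).

(** The Laplacian in the permutation representation, taken over the reals: it is
    symmetric there, as [rayleigh_eigenvalue] requires. *)
Definition perm_lap : 'M[R]_n :=
  \sum_B c B *: (1%:M - #|Sym B|%:R^-1 *: \sum_(s in Sym B) perm_mx s).

Lemma galg_mx_perm_lap :
  galg_mx (laplacianS c) (perm_repr R n) = map_mx (real_complex R) perm_lap.
Proof.
rewrite /laplacianS galg_mx_laplacian /perm_lap raddf_sum /=.
apply: eq_bigr => B _; rewrite map_mxZ map_mxB map_mx1 map_mxZ [X in _ = _ *: (_ - _ *: X)]raddf_sum /=.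
by congr (_ *: (_ - _ *: _)); apply: eq_bigr => s _; rewrite map_perm_mx.
Qed.

Lemma tr_perm_lap : perm_lap^T = perm_lap.
Proof.
rewrite linear_sum; apply: eq_bigr => B _.
rewrite linearZ linearB linearZ /= trmx1 linear_sum /=; congr (_ *: (_ - _ *: _)).
rewrite [RHS](reindex_inj invg_inj); apply: eq_big => s; last by rewrite tr_perm_mx.
by rewrite groupV.
Qed.

Lemma perm_lap_const : perm_lap *m (const_mx 1 : 'cV_n) = 0.
Proof.
rewrite mulmx_suml big1 // => B _.
rewrite -scalemxAl mulmxBl mul1mx -scalemxAl mulmx_suml.
rewrite (eq_bigr (fun=> const_mx 1)) => [|s _]; last first.
  by rewrite -row_permE; apply/matrixP=> i j; rewrite !mxE.
rewrite sumr_const -scaler_nat scalerA mulVf ?scale1r ?subrr ?scaler0 //.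
by rewrite pnatr_eq0 -lt0n cardG_gt0.
Qed.

(** A permutation supported in B fixes a with probability 1/|B| if a lies in B,
    and always otherwise; both are at least 1/n. *)
Lemma le_inv_fixed_perms (B : {set 'I_n}) (a : 'I_n) :
  n%:R^-1 <= #|Sym B|%:R^-1 * #|[set s in Sym B | s a == a]|%:R :> R.
Proof.
have n_gt0 : (0 < n)%N by apply: leq_ltn_trans (ltn_ord a).
have sub : Sym (B :\ a) \subset [set s in Sym B | s a == a].
  apply/subsetP=> s; rewrite !inE => sBa; apply/andP; split.
    exact: subset_trans sBa (subsetDl _ _).
  by rewrite (out_perm sBa) // !inE eqxx.
have le_card : (#|Sym B| <= n * #|Sym (B :\ a)|)%N.
  have leBn : (#|B| <= n)%N by rewrite -[n in X in (_ <= X)%N]card_ord max_card.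
  rewrite !card_Sym; move: leBn; rewrite (cardsD1 a B).
  case: (a \in B) => /= leBn; last by rewrite add0n leq_pmull.
  by rewrite add1n factS leq_mul2r -add1n leBn orbT.
rewrite mulrC ler_pdivlMr ?ltr0n ?cardG_gt0 // mulrC ler_pdivrMr ?ltr0n //.
rewrite -natrM ler_nat (leq_trans le_card) // mulnC leq_mul2r.
by rewrite subset_leq_card ?orbT.
Qed.

Lemma fixed_perms_out (B : {set 'I_n}) (a : 'I_n) : a \notin B ->
  #|[set s in Sym B | s a == a]| = #|Sym B|.
Proof.
move=> aB; apply: eq_card => s; rewrite !inE andb_idr // => sB.
by rewrite (out_perm sB).
Qed.

Lemma perm_lap_diag_le (a : 'I_n) : (forall B, 0 <= c B) ->
  perm_lap a a <= (\sum_(B : {set 'I_n} | a \in B) c B) * (1 - n%:R^-1).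
Proof.
move=> c_ge0; rewrite /perm_lap summxE mulr_suml [leRHS]big_mkcond ler_sum // => B _.
rewrite !mxE eqxx summxE.
rewrite (eq_bigr (fun s : 'S_n => (s a == a)%:R)) => [|s _]; last by rewrite !mxE.
have -> : \sum_(s in Sym B) (s a == a)%:R = #|[set s in Sym B | s a == a]|%:R :> R.
  rewrite -sum1_card natr_sum [RHS]big_mkcond [LHS]big_mkcond /=.
  by apply: eq_bigr => s _; rewrite [in RHS]inE; case: (s \in Sym B); case: eqP.
case: ifPn => aB.
  by rewrite ler_wpM2l // lerD2l lerN2 le_inv_fixed_perms.
rewrite fixed_perms_out // mulVf ?subrr ?mulr0 //.
by rewrite pnatr_eq0 -lt0n cardG_gt0.
Qed.

(** Every coordinate of the vector \sum_s perm_mx s *m t is the same multiple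
    of the sum of the coordinates of t. *)
Lemma sum_perm_mx_zero_sum (t : 'cV[R]_n) :
  \sum_i t i 0 = 0 -> (\sum_(s : 'S_n) perm_mx s) *m t = 0.
Proof.
move=> t0; apply/matrixP=> i j; rewrite ord1 mulmx_suml summxE [RHS]mxE.
have entryE k : \sum_(s : 'S_n) (perm_mx s *m t) k 0 = \sum_(s : 'S_n) t (s k) 0.
  by apply: eq_bigr => s _; rewrite -row_permE mxE.
have constE k : \sum_(s : 'S_n) t (s k) 0 = \sum_(s : 'S_n) t (s i) 0.
  rewrite (reindex_inj (mulgI (tperm i k))); apply: eq_bigr => s _.
  by rewrite permM tpermR.
have : \sum_k \sum_(s : 'S_n) t (s k) 0 = 0.
  rewrite exchange_big big1 // => s _.
  by rewrite -[RHS]t0 [RHS](reindex_inj (@perm_inj _ s)).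
rewrite (eq_bigr _ (fun k _ => constE k)) sumr_const card_ord => /eqP.
rewrite mulrn_eq0 entryE => /orP[/eqP n0|/eqP //].
by have := ltn_ord i; rewrite {2}n0.
Qed.

(** For v = e_a - (1, ..., 1)/n both the Laplacian and the scalar product only
    see the coordinate a: the quadratic form at v is the diagonal entry at a, and
    the square norm is 1 - 1/n.  The eigenvector u provided by the Rayleigh
    quotient may have a constant part, but pairing it with the sum-zero vector v
    still yields a matrix coefficient of total sum zero. *)
Lemma lambda_min_star_RegS_le (a : 'I_n) : (1 < n)%N -> (forall B, 0 <= c B) ->
  (lambda_min_star (laplacianS c) (Reg R 'S_n) <=
   (\sum_(B : {set 'I_n} | a \in B) c B)%:E)%E.
Proof.
move=> n_gt1 c_ge0; set w := \sum_(B | _) _.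
have n_gt0 : 0 < n%:R :> R by rewrite ltr0n ltnW.
pose one : 'cV[R]_n := const_mx 1.
pose v : 'rV[R]_n := delta_mx 0 a - n%:R^-1 *: one^T.
have vE j : v 0 j = (j == a)%:R - n%:R^-1 by rewrite !mxE mulr1.
have v1 : v *m one = 0.
  apply/matrixP=> i j; rewrite !ord1 [RHS]mxE mxE.
  rewrite (eq_bigr (fun k => (k == a)%:R - n%:R^-1)) => [|k _]; last first.
    by rewrite vE mxE mulr1.
  rewrite sumrB sumr_const card_ord -[_ *+ n]mulr_natr mulVf ?gt_eqF //.
  by rewrite -natr_sum (bigD1 a) //= eqxx big1 ?addn0 ?subrr // => k /negPf->.
have vT : v^T = delta_mx a 0 - n%:R^-1 *: one.
  by rewrite linearB linearZ /= trmxK trmx_delta.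
have inv_lt1 : n%:R^-1 < 1 :> R by rewrite invf_lt1 // ltr1n.
have nzv : v != 0.
  apply/eqP=> /rowP/(_ a); rewrite vE eqxx [RHS]mxE => /eqP.
  by rewrite subr_eq0 eq_sym lt_eqF.
have normv : (v *m v^T) 0 0 = 1 - n%:R^-1.
  by rewrite vT mulmxBr -scalemxAr v1 scaler0 subr0 -colE mxE vE eqxx.
have formv : (v *m perm_lap *m v^T) 0 0 = perm_lap a a.
  have lap1 : perm_lap *m one = 0 := perm_lap_const.
  have one_lap : one^T *m perm_lap = 0.
    by rewrite -tr_perm_lap -trmx_mul lap1 trmx0.
  rewrite {1}/v mulmxBl -scalemxAl one_lap scaler0 subr0 vT mulmxBr -scalemxAr.
  by rewrite -[_ *m one]mulmxA lap1 mulmx0 scaler0 subr0 -rowE -colE !mxE.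
have [|mu [u [le_mu eigu nzu]]] := @rayleigh_eigenvalue _ _ _ v w tr_perm_lap nzv.
  by rewrite formv normv perm_lap_diag_le.
set t := map_mx _ _ in nzu.
have nzut : (u *m t) 0 0 != 0.
  apply: contraNneq nzu => ut0; apply/eqP/matrixP=> i j.
  by rewrite !ord1 ut0 mxE.
apply: (@le_trans _ _ mu%:E); last by rewrite lee_fin.
apply: (@lambda_min_star_Reg_le _ _ _ _ _
  (fun s => re_form u (((u *m t) 0 0)^-1 *: t) (perm_repr R n s))).
apply: eigenfun_coef; first by rewrite -[laplacian _ _]/(laplacianS c) galg_mx_perm_lap.
  by rewrite /re_form mulmx1 -scalemxAr mxE mulVf // oner_eq0.
rewrite -scalemxAr -mulmxA; suff -> : (\sum_g perm_repr R n g) *m t = 0.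
  by rewrite mulmx0 scaler0.
rewrite /t; have -> : \sum_g perm_repr R n g =
    map_mx (real_complex R) (\sum_(s : 'S_n) perm_mx s).
  by rewrite raddf_sum; apply: eq_bigr => s _; rewrite /= map_perm_mx.
rewrite -map_mxM sum_perm_mx_zero_sum ?map_mx0 //.
move/matrixP/(_ 0 0): v1; rewrite [RHS]mxE mxE => {2}<-.
by apply: eq_bigr => k _; rewrite [v^T _ _]mxE [one _ _]mxE mulr1.
Qed.

End StandardBound.

(** * The spectral gap of the wreath product *)

Theorem corollary1p7 (R : realType) (n : nat) (G : finGroupType)
    (c : {set 'I_n} -> R) :
  (2 <= n)%N ->
  (forall B : {set 'I_n}, 0 <= c B) ->
  lambda_min_star (laplacianS c) (Reg R 'S_n) =
    lambda_min (laplacianS c) (std R n) ->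
  lambda_min_star (laplacianW G c) (Reg R (wreath G n)) =
    lambda_min_star (laplacianS c) (Reg R 'S_n) /\
  lambda_min_star (laplacianS c) (Reg R 'S_n) =
    lambda_min (laplacianS c) (std R n).
Proof.
move=> n_ge2 c_ge0 caputo; split=> //; apply/le_anti/andP; split.
  apply: le_lambda_min_star_Reg => x f /(eigenfun_pullback G).
  exact: lambda_min_star_Reg_le.
apply: le_lambda_min_star_Reg => x F eigF.
have [[f eigf] | [a le_x]] := wreath_eigenvalue c_ge0 eigF.
  exact: lambda_min_star_Reg_le eigf.
by apply: le_trans (lambda_min_star_RegS_le a n_ge2 c_ge0) _; rewrite lee_fin.
Qed.
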